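(* Let $F\in K[x]$ be a monic irreducible polynomial, and let $\nu\in\mathcal V_F\setminus\{\nu_0\}$ be a valuation that is not a maximal element of $(\mathcal V,\leq)$. Let $\phi\in\mathcal G_\nu$ be a homogeneous irreducible factor of $\mathrm{in}_\nu(F)$ and let $Q\in\mathrm{KP}(\nu)$ be such that $\phi=u\cdot\mathrm{in}_\nu(Q)$ for some $u\in\mathcal U_\nu$. Then there exists $\nu'\in\mathcal V$ such that $$\nu<\nu',\quad \nu(Q)<\nu'(Q),\quad \nu(F)<\nu'(F)\quad\text{and}\quad \mathrm{in}_{\nu'}(Q)\mid\mathrm{in}_{\nu'}(F)\ \text{in } \mathcal G_{\nu'}.$$
   Context: $(K,\nu_0)$ is a valued field with value group $\Gamma_0$, and $\Gamma$ is a fixed totally ordered divisible abelian group containing $\Gamma_0$; $\Gamma_\infty=\Gamma\cup\{\infty\}$ with the usual conventions. A valuation on a commutative unital ring $R$ is a map $\nu:R\to\Gamma_\infty$ with $\nu(ab)=\nu(a)+\nu(b)$, $\nu(a+b)\geq\min\{\nu(a),\nu(b)\}$, $\nu(1)=0$, $\nu(0)=\infty$; nonzero elements may have value $\infty$. Its support is $\mathrm{supp}(\nu)=\{a\in R\mid\nu(a)=\infty\}$. $\mathcal V=\{\nu_0\}\cup\{\nu:K[x]\to\Gamma_\infty\mid \nu\text{ is a valuation extending }\nu_0\}$, partially ordered by: $\nu_0\leq\nu$ for all $\nu\in\mathcal V$, and for $\nu,\mu\in\mathcal V\setminus\{\nu_0\}$, $\nu\leq\mu$ iff $\nu(f)\leq\mu(f)$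 for every $f\in K[x]$. For a monic irreducible $F\in K[x]$: $\mathcal V_{F_\infty}=\{\mu\in\mathcal V\mid\mathrm{supp}(\mu)=(F)\}$ and $\mathcal V_F=\{\nu\in\mathcal V\mid\nu\leq\mu\text{ for some }\mu\in\mathcal V_{F_\infty}\}$. For $\nu\in\mathcal V\setminus\{\nu_0\}$, the graded ring is $\mathcal G_\nu=\bigoplus_{\gamma\in\nu(K[x]),\,\gamma<\infty}\mathcal P_\gamma/\mathcal P_\gamma^+$, where $\mathcal P_\gamma=\{a\in K[x]\mid\nu(a)\geq\gamma\}$ and $\mathcal P_\gamma^+=\{a\in K[x]\mid\nu(a)>\gamma\}$, with multiplication induced by that of $K[x]$ (it is an integral domain). $\mathcal U_\nu$ is the set of units of $\mathcal G_\nu$. For $a\notin\mathrm{supp}(\nu)$, $\mathrm{in}_\nu(a)$ is the image of $a$ in $\mathcal P_{\nu(a)}/\mathcal P_{\nu(a)}^+\subseteq\mathcal G_\nu$; for $a\in\mathrm{supp}(\nu)$, $\mathrm{in}_\nu(a)=0$. $\mathrm{KP}(\nu)$ is the set of Mac Lane–Vaquié key polynomials for $\nu$: monic $Q\in K[x]$ such that $\mathrm{in}_\nu(Q)$ is a prime element of $\mathcal G_\nu$ and, for every nonzero $f\in K[x]$, $\mathrm{in}_\nu(Q)\mid\mathrm{in}_\nu(f)$ implies $\deg(Q)\leq\deg(f)$. (It is known that every homogeneous irreducible element of $\mathcal G_\nu$ has the form $u\cdot\mathrm{in}_\nu(Q)$ with $u\in\mathcal U_\nu$ and $Q\in\mathrm{KP}(\nu)$.)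 *)

(* Defs.v *)
From HB Require Import structures.
From mathcomp Require Import all_boot all_order all_algebra.
From mathcomp Require Import boolp.

Set Implicit Arguments.
Unset Strict Implicit.
Unset Printing Implicit Defensive.

Import Order.TTheory GRing.Theory Num.Theory.
Local Open Scope ring_scope.

(* Totality is an axiom of the mixin: HB has no join of Order.Total and
   GRing.Zmodule below realDomainType, and rejects a new one. *)
HB.mixin Record isTotallyOrderedGroup G of Num.POrderedZmodule G := {
  oag_le_total : total (<=%R : rel G);
  oag_lerD2l : forall z x y : G, x <= y -> z + x <= z + y
}.

#[short(type="oagType")]
HB.structure Definition OrderedAbelianGroup :=
  {G of Num.POrderedZmodule G & isTotallyOrderedGroup G}.

Definition divisible_group (G : zmodType) : Prop :=
  forall (n : nat) (g : G), (0 < n)%N -> exists h : G, h *+ n = g.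

Inductive withInf (G : Type) : Type := Fin of G | Infty.
Arguments Fin {G} _.
Arguments Infty {G}.

Section WithInf.
Variable G : oagType.
Local Notation Ginf := (withInf G).

Definition withInf_to_option (x : Ginf) : option G :=
  if x is Fin g then Some g else None.
Definition withInf_of_option (x : option G) : Ginf :=
  if x is Some g then Fin g else Infty.

Lemma withInf_to_optionK : cancel withInf_to_option withInf_of_option.
Proof. by case. Qed.

HB.instance Definition _ := Choice.copy Ginf (can_type withInf_to_optionK).

Definition inf_le (x y : Ginf) : bool :=
  match x, y with
  | _, Infty => true
  | Infty, Fin _ => false
  | Fin a, Fin b => a <= b
  end.

Lemma inf_le_anti : antisymmetric inf_le.
Proof. by case=> [a|] [b|] //= /le_anti ->. Qed.

Lemma inf_le_trans : transitive inf_le.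
Proof. by case=> [a|] [b|] [c|] //=; apply: le_trans. Qed.

Lemma inf_le_total : total inf_le.
Proof. by case=> [a|] [b|] //=; apply: oag_le_total. Qed.

HB.instance Definition _ := Order.isOrder.Build ring_display Ginf
  (fun _ _ => erefl) (fun _ _ => erefl) (fun _ _ => erefl)
  inf_le_anti inf_le_trans inf_le_total.

Definition inf_add (x y : Ginf) : Ginf :=
  match x, y with
  | Fin a, Fin b => Fin (a + b)
  | _, _ => Infty
  end.

Lemma inf_addA : associative inf_add.
Proof. by case=> [a|] [b|] [c|] //=; rewrite addrA. Qed.

Lemma inf_addC : commutative inf_add.
Proof. by case=> [a|] [b|] //=; rewrite addrC. Qed.

Lemma inf_add0 : left_id (Fin 0) inf_add.
Proof. by case=> [a|] //=; rewrite add0r. Qed.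

HB.instance Definition _ :=
  GRing.isNmodule.Build Ginf inf_addA inf_addC inf_add0.

Lemma FinD (a b : G) : Fin (a + b) = Fin a + Fin b. Proof. by []. Qed.
Lemma Fin_le (a b : G) : (Fin a <= Fin b) = (a <= b). Proof. by []. Qed.
Lemma Fin_lt (a b : G) : (Fin a < Fin b) = (a < b).
Proof. by rewrite !lt_def. Qed.
Lemma inf_leI (x : Ginf) : x <= Infty. Proof. by case: x. Qed.
Lemma inf_ltI (a : G) : Fin a < Infty. Proof. by []. Qed.
Lemma Fin_inj : injective (@Fin G). Proof. by move=> a b []. Qed.

Lemma oag_ltrD2l (z x y : G) : x < y -> z + x < z + y.
Proof.
rewrite !lt_def => /andP[ne le]; rewrite oag_lerD2l // andbT.
by apply: contra ne => /eqP/addrI ->.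
Qed.

Lemma oag_lerD (x y z t : G) : x <= y -> z <= t -> x + z <= y + t.
Proof.
move=> xy zt; apply: (le_trans (oag_lerD2l x _ _ zt)).
by rewrite ![_ + t]addrC oag_lerD2l.
Qed.

Lemma inf_leD (x y z t : Ginf) : x <= y -> z <= t -> x + z <= y + t.
Proof.
case: x y z t => [x|] [y|] [z|] [t|] //; rewrite ?inf_leI //.
exact: oag_lerD.
Qed.

Lemma inf_ltD (a b : G) (x y : Ginf) :
  Fin a <= x -> Fin b < y -> Fin (a + b) < x + y.
Proof.
case: x y => [x|] [y|] //; rewrite !Fin_lt Fin_le => ax bY.
apply: (lt_le_trans (oag_ltrD2l a bY)).
by rewrite ![_ + y]addrC oag_lerD2l.
Qed.

Lemma oag_addrr_eq0 (x : G) : x + x = 0 -> x = 0.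
Proof.
move=> xx; apply/eqP; apply: contraT => x0.
have := oag_le_total x 0; rewrite !le_eqVlt (negPf x0) eq_sym (negPf x0) /=.
case/orP => h.
- have := oag_ltrD2l x h; rewrite xx addr0 => /lt_trans /(_ h).
  by rewrite ltxx.
- have := oag_ltrD2l x h; rewrite xx addr0 => /(lt_trans h).
  by rewrite ltxx.
Qed.

End WithInf.

Record valuation (R : comNzRingType) (G : oagType) := Valuation {
  val_fun :> R -> withInf G;
  valuationM : forall a b, val_fun (a * b) = val_fun a + val_fun b;
  valuationD : forall a b, Num.min (val_fun a) (val_fun b) <= val_fun (a + b);
  valuation1 : val_fun 1 = Fin 0;
  valuation0 : val_fun 0 = Infty
}.

Definition val_supp (R : comNzRingType) (G : oagType) (nu : valuation R G)
  (a : R) : Prop := nu a = Infty.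

Lemma valuation_inj (R : comNzRingType) (G : oagType) (nu mu : valuation R G) :
  nu =1 mu -> nu = mu.
Proof.
case: nu mu => [f fM fD f1 f0] [g gM gD g1 g0] /= /funext fg.
by subst g; congr Valuation; apply: Prop_irrelevance.
Qed.

Section Filtration.
Variables (R : comNzRingType) (G : oagType) (nu : valuation R G).

Lemma valuationN a : nu (- a) = nu a.
Proof.
rewrite -mulN1r valuationM; suff -> : nu (- 1) = 0 by rewrite add0r.
have := valuationM nu (- 1) (- 1); rewrite mulrNN mulr1 valuation1.
by case: (nu (- 1)) => [g|] // [] /esym/oag_addrr_eq0 ->.
Qed.

Lemma valuation_leB x a b : x <= nu a -> x <= nu b -> x <= nu (a - b).
Proof.
move=> xa xb; apply: le_trans (valuationD nu _ _).
by rewrite le_min xa valuationN.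
Qed.

Lemma valuation_ltB x a b : x < nu a -> x < nu b -> x < nu (a - b).
Proof.
move=> xa xb; apply: lt_le_trans (valuationD nu _ _).
by rewrite lt_min xa valuationN.
Qed.

Definition val_ge (g : G) : {pred R} := fun a => Fin g <= nu a.

Lemma val_ge_zmod_closed g : zmod_closed (val_ge g).
Proof.
by split=> [|a b]; rewrite -!topredE /= /val_ge ?valuation0 //; apply: valuation_leB.
Qed.

HB.instance Definition _ g :=
  GRing.isZmodClosed.Build R (val_ge g) (val_ge_zmod_closed g).

Record val_ge_type (g : G) := ValGe {
  val_ge_val :> R;
  val_geP : val_ge_val \in val_ge g
}.

HB.instance Definition _ g := [isSub for @val_ge_val g].
HB.instance Definition _ g := [Choice of val_ge_type g by <:].
HB.instance Definition _ g :=
  [SubChoice_isSubZmodule of val_ge_type g by <:].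

Definition val_gt (g : G) : {pred val_ge_type g} :=
  fun a => Fin g < nu (val a).

Lemma val_gt_zmod_closed g : zmod_closed (@val_gt g).
Proof.
split=> [|a b]; rewrite -!topredE /= /val_gt ?raddf0 ?valuation0 //.
by rewrite raddfB; apply: valuation_ltB.
Qed.

HB.instance Definition _ g :=
  GRing.isZmodClosed.Build (val_ge_type g) (@val_gt g) (@val_gt_zmod_closed g).

(* The component of degree g.  It is trivial unless g is the value of some
   element (lemma gr_piece_trivial), so taking the direct sum over all of G is
   the same as taking it over the finite values of nu. *)
Definition gr_piece (g : G) : zmodType := Quotient.quot (@val_gt g).

Definition gr_class (g : G) (a : val_ge_type g) : gr_piece g :=
  (\pi_(Quotient.quot (@val_gt g)) a)%qT.

Lemma gr_class_eq g (a b : val_ge_type g) :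
  (gr_class a == gr_class b) = (Fin g < nu (val a - val b)).
Proof. by rewrite /gr_class -Quotient.idealrBE -topredE /= /val_gt raddfB. Qed.

Lemma gr_class_zmod_morphism g : zmod_morphism (@gr_class g).
Proof. by move=> a b; rewrite /gr_class !piE. Qed.

HB.instance Definition _ g :=
  GRing.isZmodMorphism.Build (val_ge_type g) (gr_piece g) (@gr_class g)
    (@gr_class_zmod_morphism g).

Definition gr_repr (g : G) (x : gr_piece g) : val_ge_type g := repr x.

Lemma gr_reprK g : cancel (@gr_repr g) (@gr_class g).
Proof. exact: reprK. Qed.

Lemma gr_piece_trivial g (x : gr_piece g) :
  (forall a, nu a != Fin g) -> x = 0.
Proof.
move=> ng; rewrite -[x]gr_reprK -(raddf0 (@gr_class g)); apply/eqP.
rewrite gr_class_eq raddf0 addr0 lt_def ng.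
exact: (val_geP (gr_repr x)).
Qed.

Lemma val_geM g h (a : val_ge_type g) (b : val_ge_type h) :
  val a * val b \in val_ge (g + h).
Proof.
rewrite -topredE /= /val_ge valuationM FinD.
by apply: inf_leD; [apply: (val_geP a) | apply: (val_geP b)].
Qed.

Definition gr_piece_mul g h (x : gr_piece g) (y : gr_piece h) :
    gr_piece (g + h) :=
  gr_class (ValGe (val_geM (gr_repr x) (gr_repr y))).

Lemma gr_piece_mul_class g h (a : val_ge_type g) (b : val_ge_type h) :
  gr_piece_mul (gr_class a) (gr_class b) = gr_class (ValGe (val_geM a b)).
Proof.
apply/eqP; rewrite gr_class_eq /=.
set a' := gr_repr _; set b' := gr_repr _.
have da : Fin g < nu (val a' - val a) by rewrite -gr_class_eq gr_reprK.
have db : Fin h < nu (val b' - val b) by rewrite -gr_class_eq gr_reprK.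
have -> : val_ge_val a' * val_ge_val b' - val_ge_val a * val_ge_val b =
  val a' * (val b' - val b) - (val b * - (val a' - val a)).
  rewrite mulrN opprK [val b * _]mulrC mulrBr mulrBl addrA subrK.
  by [].
apply: valuation_ltB; rewrite valuationM.
- by apply: inf_ltD => //; apply: (val_geP a').
- rewrite [g + h]addrC valuationN.
  by apply: inf_ltD => //; apply: (val_geP b).
Qed.

End Filtration.

Arguments gr_piece {R G} nu g.
Arguments gr_class {R G nu g} a.

(* The direct sum of the components: families with finite support. *)
Record graded_ring (R : comNzRingType) (G : oagType) (nu : valuation R G) :=
  Graded {
    gr_comp :> forall g, gr_piece nu g;
    gr_fin : exists s : seq G, forall g, gr_comp g != 0 -> g \in s
  }.

Section GradedRing.
Variables (R : comNzRingType) (G : oagType) (nu : valuation R G).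
Local Notation gr := (graded_ring nu).

Lemma gr_ext (x y : gr) : (forall g, x g = y g) -> x = y.
Proof.
case: x y => [x xf] [y yf] /= xy.
have {}xy : x = y by apply: functional_extensionality_dep.
by subst y; congr Graded; apply: Prop_irrelevance.
Qed.

HB.instance Definition _ := gen_eqMixin gr.
HB.instance Definition _ := gen_choiceMixin gr.

Lemma gr_zero_fin : exists s : seq G, forall g, (0 : gr_piece nu g) != 0 -> g \in s.
Proof. by exists [::] => g; rewrite eqxx. Qed.

Lemma gr_opp_fin (x : gr) :
  exists s : seq G, forall g, - x g != 0 -> g \in s.
Proof. by have [s hs] := gr_fin x; exists s => g; rewrite oppr_eq0 => /hs. Qed.

Lemma gr_add_fin (x y : gr) :
  exists s : seq G, forall g, x g + y g != 0 -> g \in s.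
Proof.
have [s hs] := gr_fin x; have [t ht] := gr_fin y; exists (s ++ t) => g.
rewrite mem_cat; have [->|/hs -> //] := eqVneq (x g) 0.
by rewrite add0r => /ht ->; rewrite orbT.
Qed.

Definition gr_zero : gr := Graded gr_zero_fin.
Definition gr_opp (x : gr) : gr := Graded (gr_opp_fin x).
Definition gr_add (x y : gr) : gr := Graded (gr_add_fin x y).

Lemma gr_addA : associative gr_add.
Proof. by move=> x y z; apply: gr_ext => g /=; rewrite addrA. Qed.
Lemma gr_addC : commutative gr_add.
Proof. by move=> x y; apply: gr_ext => g /=; rewrite addrC. Qed.
Lemma gr_add0 : left_id gr_zero gr_add.
Proof. by move=> x; apply: gr_ext => g /=; rewrite add0r. Qed.
Lemma gr_addN : left_inverse gr_zero gr_opp gr_add.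
Proof. by move=> x; apply: gr_ext => g /=; rewrite addNr. Qed.

HB.instance Definition _ :=
  GRing.isZmodule.Build gr gr_addA gr_addC gr_add0 gr_addN.

Definition gr_proj (g : G) (x : gr) : gr_piece nu g := x g.

Lemma gr_proj_zmod_morphism g : zmod_morphism (gr_proj g).
Proof. by []. Qed.

HB.instance Definition _ g :=
  GRing.isZmodMorphism.Build gr (gr_piece nu g) (gr_proj g)
    (gr_proj_zmod_morphism g).

Lemma gr_compD (x y : gr) g : (x + y) g = x g + y g. Proof. by []. Qed.
Lemma gr_comp0 g : (0 : gr) g = 0. Proof. by []. Qed.
Lemma gr_comp_sum I (r : seq I) (F : I -> gr) g :
  (\sum_(i <- r) F i) g = \sum_(i <- r) F i g.
Proof. exact: (raddf_sum (gr_proj g)). Qed.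

Lemma gr_single_fin g (x : gr_piece nu g) :
  exists s : seq G,
    forall h, dfwith (fun k => 0 : gr_piece nu k) x h != 0 -> h \in s.
Proof.
exists [:: g] => h; rewrite inE; case: dfwithP => [|k gk]; first by rewrite eqxx.
by rewrite eqxx.
Qed.

Definition gr_single g (x : gr_piece nu g) : gr := Graded (gr_single_fin x).

Lemma gr_single_in g (x : gr_piece nu g) : gr_single x g = x.
Proof. exact: dfwith_in. Qed.
Lemma gr_single_out g h (x : gr_piece nu g) : g != h -> gr_single x h = 0.
Proof. exact: dfwith_out. Qed.

Lemma gr_single_zmod_morphism g : zmod_morphism (@gr_single g).
Proof.
move=> x y; apply: gr_ext => h; rewrite gr_compD.
have -> : (- gr_single y) h = - gr_single y h by [].
have [<-|gh] := eqVneq g h; first by rewrite !gr_single_in.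
by rewrite !gr_single_out // subr0.
Qed.

HB.instance Definition _ g :=
  GRing.isZmodMorphism.Build (gr_piece nu g) gr (@gr_single g)
    (@gr_single_zmod_morphism g).

Definition gr_supp (x : gr) : seq G :=
  [seq g <- undup (sval (cid (gr_fin x))) | x g != 0].

Lemma gr_supp_uniq x : uniq (gr_supp x).
Proof. by rewrite filter_uniq ?undup_uniq. Qed.

Lemma mem_gr_supp x g : (g \in gr_supp x) = (x g != 0).
Proof.
rewrite mem_filter mem_undup; case: cid => s hs /=.
exact/andb_idr/hs.
Qed.

Lemma gr_sum_supp (V : nmodType) (x : gr) (s : seq G)
    (F : forall g, gr_piece nu g -> V) :
  uniq s -> {subset gr_supp x <= s} -> (forall g, F g 0 = 0) ->
  \sum_(g <- gr_supp x) F g (x g) = \sum_(g <- s) F g (x g).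
Proof.
move=> us sub F0.
rewrite [RHS](bigID (mem (gr_supp x))) /= [X in _ + X]big1 ?addr0; last first.
  by move=> g; rewrite mem_gr_supp negbK => /eqP ->.
rewrite -[RHS]big_filter; apply: perm_big; apply: uniq_perm.
- exact: gr_supp_uniq.
- exact: filter_uniq.
- by move=> g; rewrite [RHS]mem_filter; apply/esym/andb_idr/sub.
Qed.

Lemma gr_decomp (x : gr) : x = \sum_(g <- gr_supp x) gr_single (x g).
Proof.
apply: gr_ext => h; rewrite gr_comp_sum.
have [hs|hs] := boolP (h \in gr_supp x).
  rewrite (big_rem h) // gr_single_in big_seq big1 => [|g]; first exact/esym/addr0.
  rewrite mem_rem_uniq ?gr_supp_uniq // inE => /andP[gh _].
  by rewrite gr_single_out.
move: (hs); rewrite mem_gr_supp negbK => /eqP ->; rewrite big_seq big1 // => g gs.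
by rewrite gr_single_out //; apply: contraNneq hs => <-.
Qed.

Definition gr_one : gr :=
  gr_single (gr_class (insubd 0 1 : val_ge_type nu 0)).

(* The product of the components of degrees g and h is induced by the product
   of R and has degree g + h; it is extended biadditively. *)
Definition gr_mul (x y : gr) : gr :=
  \sum_(g <- gr_supp x) \sum_(h <- gr_supp y)
    gr_single (gr_piece_mul (x g) (y h)).

(* gr_hom g a is the class of a in degree g, and 0 if nu a < g. *)
Definition gr_hom (g : G) (a : R) : gr :=
  gr_single (gr_class (insubd 0 a : val_ge_type nu g)).

Lemma gr_hom_class g (a : val_ge_type nu g) :
  gr_single (gr_class a) = gr_hom g (val a).
Proof. by rewrite /gr_hom valKd. Qed.

Lemma gr_homB g a b : a \in val_ge nu g -> b \in val_ge nu g ->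
  gr_hom g (a - b) = gr_hom g a - gr_hom g b.
Proof.
move=> ha hb; rewrite -[a](insubdK (0 : val_ge_type nu g) ha).
rewrite -[b](insubdK (0 : val_ge_type nu g) hb).
by rewrite -raddfB -!gr_hom_class !raddfB.
Qed.

Lemma gr_hom0 g : gr_hom g 0 = 0.
Proof. by rewrite -(raddf0 (val : val_ge_type nu g -> R)) -gr_hom_class !raddf0. Qed.

Lemma gr_single_mul g h (x : gr_piece nu g) (y : gr_piece nu h) :
  gr_single (gr_piece_mul x y) = gr_hom (g + h) (val (gr_repr x) * val (gr_repr y)).
Proof. by rewrite gr_hom_class. Qed.

Lemma gr_piece_mulC g h (x : gr_piece nu g) (y : gr_piece nu h) :
  gr_single (gr_piece_mul x y) = gr_single (gr_piece_mul y x).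
Proof. by rewrite !gr_single_mul mulrC addrC. Qed.

Lemma gr_piece_mulBl g h (x x' : gr_piece nu g) (y : gr_piece nu h) :
  gr_piece_mul (x - x') y = gr_piece_mul x y - gr_piece_mul x' y.
Proof.
rewrite -[x]gr_reprK -[x']gr_reprK -[y]gr_reprK -raddfB !gr_piece_mul_class.
by rewrite -raddfB; congr gr_class; apply: val_inj; rewrite /= mulrBl.
Qed.

Lemma gr_piece_mul0l g h (y : gr_piece nu h) :
  gr_piece_mul (0 : gr_piece nu g) y = 0.
Proof. by have := gr_piece_mulBl (0 : gr_piece nu g) 0 y; rewrite !subrr. Qed.

Lemma gr_piece_mulDl g h (x x' : gr_piece nu g) (y : gr_piece nu h) :
  gr_piece_mul (x + x') y = gr_piece_mul x y + gr_piece_mul x' y.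
Proof.
rewrite -[x' in LHS]opprK gr_piece_mulBl; congr (_ + _).
by rewrite -[- x']sub0r gr_piece_mulBl gr_piece_mul0l sub0r opprK.
Qed.

Lemma gr_piece_mul0r g h (x : gr_piece nu g) :
  gr_single (gr_piece_mul x (0 : gr_piece nu h)) = 0.
Proof. by rewrite gr_piece_mulC gr_piece_mul0l raddf0. Qed.

Lemma gr_mulE (x y : gr) (s t : seq G) :
  uniq s -> {subset gr_supp x <= s} -> uniq t -> {subset gr_supp y <= t} ->
  gr_mul x y = \sum_(g <- s) \sum_(h <- t) gr_single (gr_piece_mul (x g) (y h)).
Proof.
move=> us xs ut yt; rewrite /gr_mul.
rewrite (gr_sum_supp (F := fun g z =>
  \sum_(h <- gr_supp y) gr_single (gr_piece_mul z (y h))) us xs); last first.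
  by move=> g; rewrite big1 // => h _; rewrite gr_piece_mul0l raddf0.
apply: eq_bigr => g _.
rewrite (gr_sum_supp (F := fun h z => gr_single (gr_piece_mul (x g) z)) ut yt) //.
by move=> h; rewrite gr_piece_mul0r.
Qed.

Lemma gr_mulC : commutative gr_mul.
Proof.
move=> x y; rewrite /gr_mul exchange_big; apply: eq_bigr => g _.
by apply: eq_bigr => h _; rewrite gr_piece_mulC.
Qed.

Lemma gr_mulDl : left_distributive gr_mul +%R.
Proof.
move=> x y z; set s := undup (gr_supp x ++ gr_supp y ++ gr_supp (x + y)).
have us : uniq s by apply: undup_uniq.
have uz := gr_supp_uniq z.
have E w : {subset gr_supp w <= s} -> gr_mul w z = _ :=
  fun h => gr_mulE us h uz (fun _ => id).
rewrite !E; first last.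
- by move=> g gs; rewrite mem_undup !mem_cat gs ?orbT.
- by move=> g gs; rewrite mem_undup !mem_cat gs ?orbT.
- by move=> g gs; rewrite mem_undup !mem_cat gs ?orbT.
rewrite -big_split; apply: eq_bigr => g _; rewrite -big_split.
by apply: eq_bigr => h _; rewrite gr_compD gr_piece_mulDl raddfD.
Qed.

Lemma gr_mul0l x : gr_mul 0 x = 0.
Proof.
have /eqP := gr_mulDl 0 0 x; rewrite addr0.
by rewrite -subr_eq subrr => /eqP <-.
Qed.

Lemma gr_mul_suml I (r : seq I) (F : I -> gr) y :
  gr_mul (\sum_(i <- r) F i) y = \sum_(i <- r) gr_mul (F i) y.
Proof.
elim: r => [|i r IH]; first by rewrite !big_nil gr_mul0l.
by rewrite !big_cons -IH; apply: gr_mulDl.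
Qed.

Lemma gr_mul_sumr I (r : seq I) (F : I -> gr) y :
  gr_mul y (\sum_(i <- r) F i) = \sum_(i <- r) gr_mul y (F i).
Proof. by rewrite gr_mulC gr_mul_suml; apply: eq_bigr => i _; apply: gr_mulC. Qed.

Lemma gr_supp_single g (x : gr_piece nu g) :
  {subset gr_supp (gr_single x) <= [:: g]}.
Proof.
move=> h; rewrite mem_gr_supp inE; apply: contraR; rewrite eq_sym => gh.
by rewrite gr_single_out.
Qed.

Lemma gr_mul_single g h (x : gr_piece nu g) (y : gr_piece nu h) :
  gr_mul (gr_single x) (gr_single y) = gr_single (gr_piece_mul x y).
Proof.
rewrite (@gr_mulE _ _ [:: g] [:: h]) //; try exact: gr_supp_single.
by rewrite !big_seq1 !gr_single_in.
Qed.

Lemma gr_hom_mul g h a b : a \in val_ge nu g -> b \in val_ge nu h ->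
  gr_mul (gr_hom g a) (gr_hom h b) = gr_hom (g + h) (a * b).
Proof.
move=> ha hb; rewrite /gr_hom gr_mul_single gr_piece_mul_class.
by rewrite gr_hom_class /= !insubdK.
Qed.

Lemma gr_singleE g (x : gr_piece nu g) : gr_single x = gr_hom g (val (gr_repr x)).
Proof. by rewrite -gr_hom_class gr_reprK. Qed.

Lemma gr_mulA : associative gr_mul.
Proof.
have A1 g h k (p : gr_piece nu g) (q : gr_piece nu h) (r : gr_piece nu k) :
    gr_mul (gr_single p) (gr_mul (gr_single q) (gr_single r)) =
    gr_mul (gr_mul (gr_single p) (gr_single q)) (gr_single r).
  rewrite !gr_singleE.
  set a := gr_repr p; set b := gr_repr q; set c := gr_repr r.
  by rewrite !gr_hom_mul ?mulrA ?addrA //; try exact: val_geM; exact: valP.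
have A2 g h (p : gr_piece nu g) (q : gr_piece nu h) z :
    gr_mul (gr_single p) (gr_mul (gr_single q) z) =
    gr_mul (gr_mul (gr_single p) (gr_single q)) z.
  by rewrite [z]gr_decomp !gr_mul_sumr; apply: eq_bigr => k _; apply: A1.
have A3 g (p : gr_piece nu g) y z :
    gr_mul (gr_single p) (gr_mul y z) = gr_mul (gr_mul (gr_single p) y) z.
  rewrite [y]gr_decomp gr_mul_suml !gr_mul_sumr gr_mul_suml.
  by apply: eq_bigr => k _; apply: A2.
move=> x y z; rewrite [x]gr_decomp !gr_mul_suml.
by apply: eq_bigr => k _; apply: A3.
Qed.

Lemma val_ge01 : 1 \in val_ge nu 0.
Proof. by rewrite -topredE /= /val_ge valuation1. Qed.

Lemma gr_mul1 : left_id gr_one gr_mul.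
Proof.
move=> x; rewrite {2}[x]gr_decomp [x in gr_mul _ x]gr_decomp gr_mul_sumr.
apply: eq_bigr => g _.
by rewrite gr_singleE gr_hom_mul ?val_ge01 ?mul1r ?add0r //; apply: valP.
Qed.

Lemma gr_hom_eq0 g a : a \in val_ge nu g -> (gr_hom g a == 0) = (Fin g < nu a).
Proof.
move=> ha; have E : val (insubd 0 a : val_ge_type nu g) = a by rewrite insubdK.
rewrite -[in RHS]E -[val _]subr0 -(raddf0 (val : val_ge_type nu g -> R)).
rewrite -gr_class_eq raddf0.
apply/eqP/eqP => [/(congr1 (gr_proj g))|e]; last by rewrite /gr_hom e raddf0.
by rewrite /gr_proj /gr_hom gr_single_in.
Qed.

Lemma gr_one_neq0 : gr_one != 0.
Proof. by rewrite (gr_hom_eq0 val_ge01) valuation1 ltxx. Qed.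

HB.instance Definition _ := GRing.Zmodule_isComNzRing.Build gr
  gr_mulA gr_mulC gr_mul1 gr_mulDl gr_one_neq0.

(* Units of the graded ring are its invertible elements; the inverse is chosen
   classically. *)
Definition gr_unit : {pred gr} := fun x => `[< exists y : gr, y * x = 1 >].

Definition gr_inv (x : gr) : gr :=
  if pselect (exists y : gr, y * x = 1) is left h then sval (cid h) else x.

Lemma gr_mulVx : {in gr_unit, left_inverse 1 gr_inv *%R}.
Proof.
move=> x /asboolP h; rewrite /gr_inv.
by case: pselect => // h'; case: cid.
Qed.

Lemma gr_unitPl : forall x y : gr, y * x = 1 -> gr_unit x.
Proof. by move=> x y yx; apply/asboolP; exists y. Qed.

Lemma gr_inv_out : {in [predC gr_unit], gr_inv =1 id}.
Proof. by move=> x /asboolP h; rewrite /gr_inv; case: pselect. Qed.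

HB.instance Definition _ := GRing.ComNzRing_hasMulInverse.Build gr
  gr_mulVx gr_unitPl gr_inv_out.

Definition gr_homogeneous (x : gr) : Prop :=
  exists g (p : gr_piece nu g), x = gr_single p.

Definition initial (a : R) : gr := if nu a is Fin g then gr_hom g a else 0.

Lemma initialM a b : initial (a * b) = initial a * initial b.
Proof.
rewrite /initial valuationM.
have hg c g : nu c = Fin g -> c \in val_ge nu g.
  by rewrite -topredE /= /val_ge => ->.
case Ea: (nu a) => [g|]; case Eb: (nu b) => [h|]; rewrite /= ?mul0r ?mulr0 //.
by symmetry; apply: gr_hom_mul; apply: hg.
Qed.

Lemma initial1 : initial 1 = 1.
Proof. by rewrite /initial valuation1. Qed.

Lemma initial_eq0 a : initial a = 0 <-> val_supp nu a.
Proof.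
rewrite /initial /val_supp; case E: (nu a) => [g|]; last by split.
split=> // /eqP; rewrite gr_hom_eq0 ?E ?ltxx //.
by rewrite -topredE /= /val_ge E.
Qed.

End GradedRing.

Definition ring_dvd (A : comUnitRingType) (a b : A) : Prop :=
  exists c : A, b = c * a.

Definition ring_prime (A : comUnitRingType) (p : A) : Prop :=
  [/\ p != 0, p \isn't a GRing.unit &
      forall a b, ring_dvd p (a * b) -> ring_dvd p a \/ ring_dvd p b].

Definition ring_irreducible (A : comUnitRingType) (p : A) : Prop :=
  [/\ p != 0, p \isn't a GRing.unit &
      forall a b, p = a * b -> a \is a GRing.unit \/ b \is a GRing.unit].

Record ext_valuation (K : fieldType) (G : oagType) (nu0 : valuation K G) :=
  ExtValuation {
    ext_val :> valuation {poly K} G;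
    ext_valC : forall c : K, ext_val c%:P = nu0 c
  }.

(* Base stands for nu0 itself, the least element: as a function on K it is not
   comparable pointwise with valuations on K[x]. *)
Inductive val_tree (K : fieldType) (G : oagType) (nu0 : valuation K G) :=
  | Base
  | Ext of ext_valuation nu0.
Arguments Base {K G nu0}.
Arguments Ext {K G nu0} _.

Fact val_tree_display : Order.disp_t. Proof. exact: Order.Disp tt tt. Qed.

Section ValTree.
Variables (K : fieldType) (G : oagType) (nu0 : valuation K G).
Local Notation tree := (val_tree nu0).

HB.instance Definition _ := gen_eqMixin tree.
HB.instance Definition _ := gen_choiceMixin tree.

Definition val_tree_le (x y : tree) : bool :=
  match x, y with
  | Base, _ => true
  | Ext _, Base => false
  | Ext nu, Ext mu => `[< forall f : {poly K}, nu f <= mu f >]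
  end.

Lemma val_tree_le_refl : reflexive val_tree_le.
Proof. by case=> //= nu; apply/asboolP. Qed.

Lemma val_tree_le_anti : antisymmetric val_tree_le.
Proof.
case=> [|nu] [|mu] //= /andP[/asboolP le1 /asboolP le2]; congr Ext.
case: nu mu le1 le2 => [nu nuC] [mu muC] /= le1 le2.
have e : nu = mu by apply: valuation_inj => f; apply: le_anti; rewrite le1 le2.
by subst mu; congr ExtValuation; apply: Prop_irrelevance.
Qed.

Lemma val_tree_le_trans : transitive val_tree_le.
Proof.
case=> [|nu] [|mu] [|la] //= /asboolP le1 /asboolP le2.
by apply/asboolP => f; apply: le_trans (le1 f) (le2 f).
Qed.

HB.instance Definition _ := Order.Le_isPOrder.Build val_tree_display tree
  val_tree_le_refl val_tree_le_anti val_tree_le_trans.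

Definition val_tree_maximal (x : tree) : Prop :=
  forall y : tree, (x <= y)%O -> y = x.

Definition tree_at_inf (F : {poly K}) (x : tree) : Prop :=
  if x is Ext mu then forall a : {poly K}, val_supp mu a <-> F %| a else False.

Definition tree_at (F : {poly K}) (x : tree) : Prop :=
  exists2 y : tree, tree_at_inf F y & (x <= y)%O.

End ValTree.

Definition key_polynomial (K : fieldType) (G : oagType)
    (nu : valuation {poly K} G) (Q : {poly K}) : Prop :=
  [/\ Q \is monic,
      ring_prime (initial nu Q) &
      forall f : {poly K}, f != 0 ->
        ring_dvd (initial nu Q) (initial nu f) -> (size Q <= size f)%N].

(* Main.v *)
Require Import Defs.
From HB Require Import structures.
From mathcomp Require Import all_boot all_order all_algebra ring.
From mathcomp Require Import boolp.

Set Implicit Arguments.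
Unset Strict Implicit.
Unset Printing Implicit Defensive.

Import Order.TTheory GRing.Theory Num.Theory.
Local Open Scope ring_scope.

(** The valuation [nu'] is an augmentation of [nu]: writing polynomials in
    base [Q], one keeps the values of the coefficients and raises the value of
    [Q] to some [gamma > nu Q], that is
    [nu' (\sum_i f_i Q^i) = min_i (nu f_i + i gamma)], where
    [deg f_i < deg Q].

    For [gamma = nu Q] this formula gives [nu] back ([key_val_expansion]),
    because the initial form of [Q] divides that of no polynomial of finite
    value and of degree less than [deg Q]. That the formula is multiplicative for larger [gamma]
    ([augmentM]) comes from the primality of the initial form of [Q]: the
    product [a * b] of two polynomials of degree less than [deg Q] has the same
    value as its remainder modulo [Q] ([key_val_mod_mul]).

    Since [nu] is not maximal, [nu F] is finite ([infinite_value_maximal]).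
    Write [F = h * Q + a] with [deg a < deg Q]. As [in_nu Q] divides [in_nu F],
    some [F - k * Q] has a value larger than [nu F]; its remainder modulo [Q]
    is [a], so that [nu F < nu a]. Hence [nu F = nu Q + nu h < nu a]: in the
    minimum that gives [nu F] the constant term does not take part. Raising the
    value of [Q] therefore raises that of [F] ([augmented_expansion_gt]). If it
    is raised so little that the constant term still does not take part
    ([exists_augmented_dvd]), then [F] and [h * Q] have the same initial form
    for [nu'], and [in_nu' Q] divides it. Divisibility of the value group
    leaves room for such a small raise. When [nu a] is infinite, one takes
    [gamma] infinite instead, and the initial forms of [Q] and [F] for [nu']
    are both zero. *)

(** * Ordered groups with a point at infinity *)

Section OrderedGroup.
Variable G : oagType.
Implicit Types (g e : G) (x y z : withInf G).

Lemma inf_add_minr x y z : x + Num.min y z = Num.min (x + y) (x + z).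
Proof.
by case: (leP y z) => [yz|/ltW zy]; apply/esym;
   [apply: min_l | apply: min_r]; apply: inf_leD.
Qed.

Lemma oag_subr_gt0 g e : g < e -> 0 < e - g.
Proof. by move=> /(oag_ltrD2l (- g)); rewrite addNr addrC. Qed.

Lemma oag_mulrn_le0 g n : g <= 0 -> g *+ n <= 0.
Proof.
move=> g0; elim: n => [|n IH]; first by rewrite mulr0n.
by rewrite mulrS -[leRHS]addr0 oag_lerD.
Qed.

(** Dividing [g] by [i.+1] makes [i] copies of the result fall strictly short
    of it. *)
Lemma oag_small_fraction (i : nat) g : divisible_group G -> 0 < g ->
  exists2 e : G, 0 < e & e *+ i < g.
Proof.
move=> Gdiv g0; have [e eg] := Gdiv i.+1 g isT.
have e0 : 0 < e.
  rewrite lt_def; have /orP[e0|e0] := oag_le_total e 0.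
    by move: g0; rewrite -eg => /lt_le_trans/(_ (oag_mulrn_le0 i.+1 e0));
       rewrite ltxx.
  rewrite e0 andbT; apply: contraTneq g0 => e00.
  by rewrite -eg e00 mul0rn ltxx.
exists e => //; rewrite -eg mulrSr -[ltLHS]addr0.
exact: oag_ltrD2l.
Qed.

End OrderedGroup.

(** * Initial forms *)

Section Initial.
Variables (R : comNzRingType) (G : oagType) (nu : valuation R G).
Implicit Types a b c : R.

Lemma val_geE g a : (a \in val_ge nu g) = (Fin g <= nu a).
Proof. by []. Qed.

Lemma valuationD_lt a b : nu a < nu b -> nu (a + b) = nu a.
Proof.
move=> ab; apply: le_anti; apply/andP; split; last first.
  by have := valuationD nu a b; rewrite min_l // ltW.
rewrite leNgt; apply/negP => ltab.
by have := valuation_ltB ltab ab; rewrite addrK ltxx.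
Qed.

Lemma initial_eq a b : nu a < nu (a - b) -> initial nu a = initial nu b.
Proof.
move=> lab; have eab : nu b = nu a.
  have -> : b = a - (a - b) by rewrite opprB addrC subrK.
  by rewrite valuationD_lt // valuationN.
rewrite /initial eab; case Ea: (nu a) => [g|] //; apply/eqP.
have ha c : nu c = nu a -> c \in val_ge nu g.
  by move=> ec; rewrite val_geE ec Ea.
rewrite -(subr_eq0 (gr_hom nu g a)) -gr_homB ?ha //.
rewrite gr_hom_eq0; first by rewrite -Ea.
by rewrite val_geE -Ea ltW.
Qed.

Lemma gr_homD g a b : a \in val_ge nu g -> b \in val_ge nu g ->
  gr_hom nu g (a + b) = gr_hom nu g a + gr_hom nu g b.
Proof.
move=> ha hb; have := gr_homB (rpredD ha hb) hb.
by rewrite addrK => ->; rewrite subrK.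
Qed.

(** Only the component of the quotient in degree [nu b - nu a] matters, and it
    is the class of an element of [R]. *)
Lemma initial_dvd a b :
  ring_dvd (initial nu a) (initial nu b) -> nu b != Infty ->
  exists c, nu b < nu (b - c * a).
Proof.
case=> y; case Eb: (nu b) => [g|] // + _.
have hb : b \in val_ge nu g by rewrite val_geE Eb.
rewrite {1}/initial Eb; case Ea: (nu a) => [q|]; last first.
  rewrite /initial Ea mulr0 => /eqP.
  by rewrite gr_hom_eq0 // Eb ltxx.
have ha : a \in val_ge nu q by rewrite val_geE Ea.
rewrite /initial Ea [y]gr_decomp mulr_suml => /(congr1 (gr_proj g)).
rewrite raddf_sum.
have : exists2 c, c * a \in val_ge nu g &
  \sum_(k <- gr_supp y) gr_proj g (gr_single (y k) * gr_hom nu q a) =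
  gr_proj g (gr_hom nu g (c * a)).
  elim: (gr_supp y) => [|k s [c hc IH]].
    exists 0; first by rewrite mul0r rpred0.
    by rewrite big_nil mul0r gr_hom0 raddf0.
  rewrite big_cons IH gr_singleE.
  have hk : val (gr_repr (y k)) * a \in val_ge nu (k + q).
    exact: (val_geM (gr_repr (y k)) (ValGe ha)).
  rewrite [_ * gr_hom _ _ _]gr_hom_mul //; last exact: valP.
  have [kq|kq] := eqVneq (k + q) g; last first.
    by exists c => //; rewrite {1}/gr_proj gr_single_out ?add0r.
  exists (val (gr_repr (y k)) + c); first by rewrite mulrDl rpredD // -kq.
  by rewrite -raddfD kq mulrDl gr_homD // -kq.
case=> c hc -> /eqP.
rewrite -subr_eq0 -(raddfB (gr_proj g)) -gr_homB // => /eqP e.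
exists c; rewrite -gr_hom_eq0 ?rpredB //; apply/eqP/gr_ext => h.
have [<-|gh] := eqVneq g h; first exact: e.
by rewrite gr_single_out.
Qed.

Lemma ring_dvd_initial a b : ring_dvd (initial nu a) (initial nu (b * a)).
Proof. by exists (initial nu b); rewrite initialM. Qed.

End Initial.

(** * Augmentation of a valuation at a key polynomial *)

Section Augmentation.
Variables (K : fieldType) (G : oagType) (nu : valuation {poly K} G).
Variable Q : {poly K}.
Hypothesis Q_key : key_polynomial nu Q.
Implicit Types a b f g h k : {poly K}.

Lemma key_neq0 : Q != 0.
Proof. by case: Q_key => /monic_neq0. Qed.

Lemma key_size_gt1 : (1 < size Q)%N.
Proof.
case: Q_key => Qm [_ Qnu _] _; rewrite ltnNge; apply: contra Qnu => Q1.
move: Qm; rewrite (size1_polyC Q1) monicE lead_coefC => /eqP ->.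
by rewrite initial1 unitr1.
Qed.

Lemma key_small_ndvd a : (size a < size Q)%N -> nu a != Infty ->
  ~ ring_dvd (initial nu Q) (initial nu a).
Proof.
case: Q_key => _ _ min_size sa na /min_size.
rewrite leqNgt sa => /(_ (contraNneq _ na)) le.
by have /le : a = 0 -> nu a == Infty by move=> ->; rewrite valuation0.
Qed.

(** If the left side were larger, the initial forms of [a] and of [- h * Q]
    would coincide, and [in_nu Q] would divide that of a polynomial of degree
    less than [deg Q]. *)
Lemma key_val_le_rem h a : (size a < size Q)%N -> nu (h * Q + a) <= nu a.
Proof.
move=> sa; rewrite leNgt; apply/negP => lt.
apply: (key_small_ndvd sa); first by apply: contraTneq lt => ->; rewrite ltNge inf_leI.
rewrite (@initial_eq _ _ nu a (- h * Q)); first exact: ring_dvd_initial.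
by rewrite mulNr opprK addrC.
Qed.

Lemma key_val_expansion h a : (size a < size Q)%N ->
  nu (h * Q + a) = Num.min (nu a) (nu Q + nu h).
Proof.
move=> sa; have le := key_val_le_rem h sa.
rewrite [nu Q + _]addrC -valuationM; apply: le_anti; apply/andP; split.
  by rewrite le_min le; have := valuation_leB (lexx _) le; rewrite addrK.
by rewrite minC; apply: valuationD.
Qed.

(** This is where primality of [in_nu Q] enters: it does not divide the
    initial form of a product of two polynomials of degree less than
    [deg Q]. *)
Lemma key_val_mod_mul a b : (size a < size Q)%N -> (size b < size Q)%N ->
  nu ((a * b) %% Q) = nu (a * b).
Proof.
move=> sa sb; have sc : (size ((a * b) %% Q)%R < size Q)%N.
  by rewrite ltn_modp key_neq0.
apply: le_anti; rewrite [X in _ && (nu X <= _)](divp_eq (a * b) Q).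
rewrite key_val_le_rem // andbT leNgt; apply/negP => lt.
have ab : nu (a * b) != Infty.
  by apply: contraTneq lt => ->; rewrite ltNge inf_leI.
have [nza nzb] : nu a != Infty /\ nu b != Infty.
  by move: ab; rewrite valuationM; case: (nu a) (nu b) => [?|] [?|].
have : ring_dvd (initial nu Q) (initial nu a * initial nu b).
  rewrite -initialM (@initial_eq _ _ nu (a * b) ((a * b) %/ Q * Q)).
    exact: ring_dvd_initial.
  by rewrite [X in X - _](divp_eq (a * b) Q) addrC addKr.
case: Q_key => _ [_ _ pr] _ /pr[]; exact: key_small_ndvd.
Qed.

Lemma size_div_key f : f != 0 -> (size (f %/ Q)%R < size f)%N.
Proof.
move=> nz; rewrite size_divp ?key_neq0 // ltn_subrL size_poly_gt0 nz andbT.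
by rewrite -ltnS (ltn_predK key_size_gt1) key_size_gt1.
Qed.

Lemma expansion_ind (P : {poly K} -> Prop) :
  P 0 -> (forall h a, (size a < size Q)%N -> P h -> P (h * Q + a)) ->
  forall f, P f.
Proof.
move=> P0 PS f; have [n] := ubnP (size f); elim: n f => // n IH f /ltnSE fn.
have [->//|nz] := eqVneq f 0.
rewrite (divp_eq f Q); apply: PS; first by rewrite ltn_modp key_neq0.
by apply: IH; apply: leq_trans fn; apply: size_div_key.
Qed.

Variable gamma : withInf G.
Hypothesis gamma_ge : nu Q <= gamma.

Fixpoint augment_rec n f : withInf G :=
  if n is n'.+1 then Num.min (nu (f %% Q)) (gamma + augment_rec n' (f %/ Q))
  else Infty.

(** This is [min_i (nu f_i + i gamma)] for the expansion [f = \sum_i f_i Q^i]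
    with [deg f_i < deg Q]; that expansion has at most [size f] terms. *)
Definition augment f := augment_rec (size f) f.

Lemma augment_rec0 n : augment_rec n 0 = Infty.
Proof.
by elim: n => //= n IH; rewrite mod0p div0p IH valuation0; case: gamma.
Qed.

Lemma augment_rec_stable m n f : (size f <= m)%N -> (size f <= n)%N ->
  augment_rec m f = augment_rec n f.
Proof.
elim: m n f => [|m IH] n f.
  by rewrite size_poly_leq0 => /eqP -> _; rewrite !augment_rec0.
have [->|nz] := eqVneq f 0; first by rewrite !augment_rec0.
case: n => [|n] fm fn; first by move: fn; rewrite size_poly_leq0 (negPf nz).
have lt := size_div_key nz.
by rewrite /= (IH n) // -ltnS (leq_trans lt).
Qed.

Lemma augment0 : augment 0 = Infty.
Proof. exact: augment_rec0. Qed.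

Lemma augment_expansion h a : (size a < size Q)%N ->
  augment (h * Q + a) = Num.min (nu a) (gamma + augment h).
Proof.
move=> sa; set f := h * Q + a.
have -> : augment f = augment_rec (size f).+1 f by exact: augment_rec_stable.
rewrite /= modp_addl_mul_small // divp_addl_mul_small //.
suff -> : augment_rec (size f) h = augment h by [].
apply: augment_rec_stable => //.
by rewrite -(divp_addl_mul_small h sa) leq_divp.
Qed.

Lemma augment_mulQ h : augment (h * Q) = gamma + augment h.
Proof.
rewrite -[h * Q]addr0 augment_expansion ?size_poly0 ?size_poly_gt0 ?key_neq0 //.
by rewrite valuation0 min_r ?inf_leI.
Qed.

Lemma augment_small a : (size a < size Q)%N -> augment a = nu a.
Proof.
move=> sa; have := augment_expansion 0 sa.
rewrite mul0r add0r augment0 min_l //.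
by case: (gamma) => *; apply: inf_leI.
Qed.

Lemma augment_ge f : nu f <= augment f.
Proof.
elim/expansion_ind: f => [|h a sa IH]; first by rewrite augment0 inf_leI.
rewrite augment_expansion // key_val_expansion // le_min ge_min lexx /=.
by rewrite ge_min [X in _ || X]inf_leD ?orbT.
Qed.

Lemma augmentD f g : Num.min (augment f) (augment g) <= augment (f + g).
Proof.
elim/expansion_ind: f g => [|h a sa IH] g.
  by rewrite add0r ge_min lexx orbT.
have sb : (size (g %% Q)%R < size Q)%N by rewrite ltn_modp key_neq0.
rewrite (divp_eq g Q); move: (g %/ Q) (g %% Q) sb => k b sb.
have -> : h * Q + a + (k * Q + b) = (h + k) * Q + (a + b).
  by rewrite mulrDl addrACA.
rewrite !augment_expansion //; last first.
  by rewrite (leq_ltn_trans (size_polyD _ _)) // gtn_max sa.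
rewrite minACA le_min; apply/andP; split.
  by apply: le_trans (valuationD nu a b); rewrite ge_min lexx.
by rewrite ge_min -inf_add_minr [X in _ || X]inf_leD ?IH ?orbT.
Qed.

Lemma augmentN f : augment (- f) = augment f.
Proof.
elim/expansion_ind: f => [|h a sa IH]; first by rewrite oppr0.
by rewrite opprD -mulNr !augment_expansion ?size_polyN // IH valuationN.
Qed.

Lemma augmentD_le f g : augment f < augment g -> augment (f + g) <= augment f.
Proof.
move=> lt; have := augmentD (f + g) (- g); rewrite addrK augmentN ge_min.
by case/orP => // /(lt_le_trans lt); rewrite ltxx.
Qed.

Lemma augment_mul_ge f g : augment f + augment g <= augment (f * g).
Proof.
have small a : (size a < size Q)%N ->
    forall e, nu a + augment e <= augment (a * e).
  move=> sa; elim/expansion_ind => [|k b sb IH].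
    by rewrite mulr0 augment0 inf_leI.
  rewrite mulrDr mulrA; apply: le_trans (augmentD _ _).
  rewrite augment_mulQ augment_expansion // inf_add_minr le_min; apply/andP; split.
    by rewrite ge_min addrCA [X in _ || X]inf_leD ?orbT.
  by rewrite ge_min -valuationM augment_ge.
elim/expansion_ind: f g => [|h a sa IH] g; first by rewrite mul0r augment0 inf_leI.
rewrite mulrDl mulrAC; apply: le_trans (augmentD _ _).
rewrite augment_mulQ augment_expansion // le_min; apply/andP; split.
  apply: le_trans (inf_leD (lexx gamma) (IH g)).
  by rewrite addrA; apply: inf_leD; rewrite // ge_min lexx orbT.
apply: le_trans (small _ sa g); apply: inf_leD => //.
by rewrite ge_min lexx.
Qed.

(** The product with the dominated part [a] has a value strictly above that of
    [h * g * Q], so it cannot affect the value of the whole. *)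
Lemma augment_mul_le_dominated h a g : (size a < size Q)%N ->
  gamma + augment h < nu a ->
  augment (h * g) = augment h + augment g ->
  augment ((h * Q + a) * g) <= augment (h * Q + a) + augment g.
Proof.
move=> sa lt e; rewrite augment_expansion // min_r; last exact: ltW.
case Eg: (augment g) => [c|]; last first.
  by case: (_ + augment h) => *; apply: inf_leI.
have hQg : augment (h * g * Q) = gamma + augment h + augment g.
  by rewrite augment_mulQ e addrA.
rewrite -Eg mulrDl mulrAC -hQg; apply: augmentD_le; rewrite hQg.
apply: lt_le_trans (augment_mul_ge _ _).
rewrite (augment_small sa) ![_ + augment g]addrC Eg.
move: lt; case: (gamma + augment h) => [d|]; last by rewrite ltNge inf_leI.
by move=> lt; rewrite -FinD; apply: inf_ltD.
Qed.

(** When the constant term attains the minimum in the expansions of both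
    factors, the constant term [(a * b) %% Q] of the product witnesses the
    equality; otherwise one of the factors is dominated by a multiple of [Q]
    and the claim reduces to a factor with a shorter expansion. *)
Lemma augmentM f g : augment (f * g) = augment f + augment g.
Proof.
elim/expansion_ind: f g => [|h a sa IHf] g.
  by rewrite mul0r augment0.
elim/expansion_ind: g => [|k b sb IHg].
  by rewrite mulr0 augment0; case: (augment _).
apply: le_anti; rewrite augment_mul_ge andbT.
have [la|la] := ltP (gamma + augment h) (nu a).
  exact: augment_mul_le_dominated (IHf _).
have [lb|lb] := ltP (gamma + augment k) (nu b).
  rewrite (mulrC (_ + _)) (addrC (augment _)).
  apply: augment_mul_le_dominated => //.
  by rewrite mulrC IHg addrC.
rewrite [augment (h * Q + a)]augment_expansion // min_l //.
rewrite [augment (k * Q + b)]augment_expansion // min_l //.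
have -> : (h * Q + a) * (k * Q + b) =
    (h * (k * Q + b) + a * k + (a * b) %/ Q) * Q + (a * b) %% Q.
  rewrite [in RHS]mulrDl -[RHS]addrA -divp_eq; ring.
rewrite augment_expansion ?ltn_modp ?key_neq0 //.
by rewrite ge_min key_val_mod_mul // valuationM lexx.
Qed.

Lemma augment1 : augment 1 = Fin 0.
Proof. by rewrite augment_small ?valuation1 // size_poly1 key_size_gt1. Qed.

Definition augmented_valuation : valuation {poly K} G :=
  Valuation augmentM augmentD augment1 augment0.

Lemma augment_key : augment Q = gamma.
Proof.
have := augment_mulQ 1; rewrite mul1r augment1 => ->; exact: addr0.
Qed.

End Augmentation.

(** The bound is uniform in [e]: [i] is the index of a term attaining the
    minimum that gives [nu h], and that term grows by [e *+ i]. *)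
Lemma augment_le_linear (K : fieldType) (G : oagType)
    (nu : valuation {poly K} G) (Q h : {poly K}) (q : G) :
  key_polynomial nu Q -> nu Q = Fin q ->
  exists i, forall e, augment nu Q (Fin (q + e)) h <= nu h + Fin (e *+ i).
Proof.
move=> Q_key Eq; elim/(expansion_ind Q_key): h => [|h a sa [i IH]].
  by exists 0%N => e; rewrite valuation0 inf_leI.
rewrite (key_val_expansion Q_key) //.
case: (leP (nu a) (nu Q + nu h)) => [_|_].
  exists 0%N => e; rewrite augment_expansion // mulr0n [_ + Fin 0]addr0.
  by rewrite ge_min lexx.
exists i.+1 => e; rewrite augment_expansion // ge_min mulrS !FinD Eq.
by rewrite -!addrA inf_leD ?orbT // addrCA inf_leD // IH.
Qed.

(** * Valuations with nontrivial support are maximal *)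

Section Maximality.
Variables (K : fieldType) (G : oagType).

(** [f] is invertible modulo [F], with inverse [v], and [mu] factors through
    the quotient. *)
Lemma valuation_bezout (mu : valuation {poly K} G) (F f u v : {poly K}) :
  mu F = Infty -> u * F + v * f = 1 -> mu v + mu f = Fin 0.
Proof.
move=> mF; rewrite -valuationM -(valuation1 mu) => <-.
have -> : u * F + v * f = v * f - - u * F by rewrite mulNr opprK addrC.
have mM : mu (- u * F) = Infty by rewrite valuationM mF; case: (mu _).
case E : (mu (v * f)) => [g|].
  by rewrite valuationD_lt // valuationN mM E inf_ltI.
apply/eqP; rewrite eq_le inf_leI andbT.
by apply: valuation_leB; rewrite ?E ?mM.
Qed.

(** A valuation taking the value infinity at [F] comes from the field
    [K[x] / (F)], where comparable valuations coincide because the values of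
    an element and of its inverse are opposite. *)
Lemma infinite_value_maximal (nu0 : valuation K G) (nu : ext_valuation nu0)
    (F : {poly K}) :
  irreducible_poly F -> nu F = Infty -> val_tree_maximal (Ext nu).
Proof.
move=> F_irr nF [//|mu] le; apply/esym/le_anti; rewrite le /=.
move: le => /asboolP le; apply/asboolP => f.
have mF : mu F = Infty by apply/eqP; rewrite eq_le inf_leI -nF le.
have [/dvdpP[h ->]|Ff] := boolP (F %| f).
  by rewrite [nu _]valuationM nF; case: (nu h) => *; apply: inf_leI.
move: Ff; rewrite -(irreducible_poly_coprime _ F_irr).
case/Bezout_eq1_coprimepP => [[u v] /= uv].
have nE := valuation_bezout nF uv; have mE := valuation_bezout mF uv.
rewrite leNgt; apply/negP => lt; have := le v; move: nE mE lt.
case: (nu v) (nu f) (mu v) (mu f) => [a|] [b|] [c|] [d|] //= ab cd bd ac.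
by have := inf_ltD ac bd; rewrite FinD ab cd ltxx.
Qed.

End Maximality.

(** * Augmentations in the tree of extensions *)

Section ExtAugmentation.
Variables (K : fieldType) (G : oagType) (nu0 : valuation K G).
Variables (nu : ext_valuation nu0) (Q : {poly K}) (gamma : withInf G).
Hypotheses (Q_key : key_polynomial nu Q) (gamma_gt : nu Q < gamma).

Lemma augmented_valuationC (c : K) :
  augmented_valuation Q_key (ltW gamma_gt) c%:P = nu0 c.
Proof.
rewrite /= augment_small ?ext_valC //.
by rewrite (leq_ltn_trans (size_polyC_leq1 c)) // (key_size_gt1 Q_key).
Qed.

Definition augmented : ext_valuation nu0 := ExtValuation augmented_valuationC.

Lemma augmented_key : augmented Q = gamma.
Proof. exact: augment_key. Qed.

Lemma augmented_gt : (Ext nu < Ext augmented)%O.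
Proof.
rewrite lt_def; apply/andP; split; last first.
  by apply/asboolP => f; apply: augment_ge; rewrite ?ltW.
by apply/eqP => -[e]; move: gamma_gt; rewrite -augmented_key e ltxx.
Qed.

Lemma augmented_expansion_gt (h a : {poly K}) : (size a < size Q)%N ->
  nu (h * Q + a) < nu a -> nu (h * Q + a) < augmented (h * Q + a).
Proof.
move=> sa lt; rewrite /= augment_expansion // lt_min lt /=.
move: lt; rewrite key_val_expansion //.
rewrite gt_min ltxx /= => lt; rewrite min_r ?ltW //.
apply: lt_le_trans (inf_leD (lexx gamma) (augment_ge Q_key (ltW gamma_gt) h)).
move: lt gamma_gt; case: (nu Q) => [q|]; last by rewrite ltNge inf_leI.
case: (nu h) => [c|]; last by rewrite ltNge inf_leI.
by move=> _ lt; rewrite ![_ + Fin c]addrC -FinD; apply: inf_ltD.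
Qed.

Lemma augmented_dvd (h a : {poly K}) : (size a < size Q)%N ->
  gamma + augmented h < nu a ->
  ring_dvd (initial augmented Q) (initial augmented (h * Q + a)).
Proof.
move=> sa lt; rewrite (@initial_eq _ _ augmented (h * Q + a) (h * Q)).
  exact: ring_dvd_initial.
rewrite [X in X - _]addrC addrK /= (augment_small Q_key _ sa).
by rewrite augment_expansion // gt_min lt orbT.
Qed.

End ExtAugmentation.

(** If [nu a] is infinite, [gamma] is taken infinite as well, and both initial
    forms vanish. Otherwise raising the value of [Q] by [e] raises that of
    [h * Q] by at most [e *+ i.+1] for a fixed [i], and [e] is taken to keep
    this below the gap [nu a - nu (h * Q)]. *)
Lemma exists_augmented_dvd (K : fieldType) (G : oagType) (nu0 : valuation K G)
    (nu : ext_valuation nu0) (Q h a : {poly K})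
    (Q_key : key_polynomial nu Q) :
  divisible_group G -> (size a < size Q)%N -> nu (h * Q + a) < nu a ->
  exists gamma (gamma_gt : nu Q < gamma),
    ring_dvd (initial (augmented Q_key gamma_gt) Q)
      (initial (augmented Q_key gamma_gt) (h * Q + a)).
Proof.
move=> Gdiv sa; rewrite key_val_expansion // gt_min ltxx /=.
move=> lt; have [q [c [Eq Eh]]] : exists q c, nu Q = Fin q /\ nu h = Fin c.
  move: lt; case: (nu Q) => [q|]; last by rewrite ltNge inf_leI.
  case: (nu h) => [c|]; last by rewrite ltNge inf_leI.
  by exists q, c.
case Ea: (nu a) => [d|]; last first.
  exists Infty; have lt' : nu Q < Infty by rewrite Eq inf_ltI.
  exists lt'; exists 1; rewrite mul1r.
  have inf0 f : augmented Q_key lt' f = Infty -> initial (augmented Q_key lt') f = 0.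
    by move=> e; apply/initial_eq0.
  rewrite !inf0 ?augmented_key //=.
  by rewrite augment_expansion // Ea.
rewrite Eq Eh Ea -FinD Fin_lt in lt.
have [i Hi] := augment_le_linear h Q_key Eq.
have [e e0 ed] := oag_small_fraction i.+1 Gdiv (oag_subr_gt0 lt).
have lt' : nu Q < Fin (q + e).
  by rewrite Eq Fin_lt -[ltLHS]addr0; apply: oag_ltrD2l.
exists (Fin (q + e)), lt'; apply: augmented_dvd => //.
rewrite Ea; apply: le_lt_trans (inf_leD (lexx _) (Hi e)) _.
rewrite Eh -!FinD Fin_lt addrACA -mulrS.
by have := oag_ltrD2l (q + c) ed; rewrite [ltRHS]addrC subrK.
Qed.

Theorem proposition1p2 (G : oagType) (G_div : divisible_group G)
    (K : fieldType) (nu0 : valuation K G)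
    (F : {poly K}) (F_monic : F \is monic) (F_irr : irreducible_poly F)
    (nu : ext_valuation nu0)
    (nu_F : tree_at F (Ext nu))
    (nu_not_max : ~ val_tree_maximal (Ext nu))
    (phi : graded_ring nu)
    (phi_homog : gr_homogeneous phi)
    (phi_irr : ring_irreducible phi)
    (phi_dvd : ring_dvd phi (initial nu F))
    (Q : {poly K}) (Q_key : key_polynomial nu Q)
    (u : graded_ring nu) (u_unit : u \is a GRing.unit)
    (phi_Q : phi = u * initial nu Q) :
  exists nu' : ext_valuation nu0,
    [/\ (Ext nu < Ext nu')%O,
        nu Q < nu' Q,
        nu F < nu' F &
        ring_dvd (initial nu' Q) (initial nu' F)].
Proof.
have nF : nu F != Infty.
  by apply/eqP => nF; apply: nu_not_max; apply: infinite_value_maximal nF.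
(* The witness of divisibility in degree [nu F], lifted to [K[x]]. *)
have [h hF] : exists h, nu F < nu (F - h * Q).
  apply: initial_dvd nF; case: phi_dvd => y ->.
  by exists (y * u); rewrite phi_Q mulrA.
have sa : (size (F %% Q)%R < size Q)%N by rewrite ltn_modp (key_neq0 Q_key).
(* [F - h * Q] and [F] have the same remainder modulo [Q]. *)
have lt : nu F < nu (F %% Q).
  apply: lt_le_trans hF _.
  have -> : F - h * Q = (F %/ Q - h) * Q + F %% Q.
    by rewrite {1}(divp_eq F Q) mulrBl addrAC.
  exact: key_val_le_rem.
rewrite {1}(divp_eq F Q) in lt.
have [gamma [gamma_gt dvd]] := exists_augmented_dvd Q_key G_div sa lt.
exists (augmented Q_key gamma_gt); split.
- exact: augmented_gt.
- by rewrite augmented_key.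
- by rewrite (divp_eq F Q); apply: augmented_expansion_gt.
- by rewrite (divp_eq F Q).
Qed.
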